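(* (a) For every integer $k\geq 2$ there exists an irreducible nondegenerate homogeneous quadratic harmonic polynomial $P$ on $\mathbb R^{2k}$ that divides infinitely many linearly independent harmonic polynomials; that is, there is an infinite linearly independent family of harmonic polynomials on $\mathbb R^{2k}$ each of which is divisible by $P$ in the polynomial ring. (b) For every integer $k\geq 2$ there exists an irreducible nondegenerate harmonic polynomial $P$ on $\mathbb R^{2k+1}$ that divides infinitely many linearly independent harmonic polynomials; that is, there is an infinite linearly independent family of harmonic polynomials on $\mathbb R^{2k+1}$ each of which is divisible by $P$ in the polynomial ring.
   Context: Polynomials on $\mathbb R^n$ have real coefficients. A polynomial is harmonic if its Laplacian $\sum_{j=1}^n\partial^2/\partial x_j^2$ vanishes identically. A polynomial $P$ on $\mathbb R^n$ is called nondegenerate if for every nonzero vector $\omega\in\mathbb R^n$ there exists $x\in\mathbb R^n$ such that $\omega\cdot\nabla P(x)\neq 0$. A polynomial is called irreducible if it is irreducible over $\mathbb C$, i.e. irreducible as an element of $\mathbb C[x_1,\ldots,x_n]$. *)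

(* Defs.v *)
From mathcomp Require Import all_boot all_order all_algebra.
From mathcomp Require Import complex mpoly reals.

Set Implicit Arguments.
Unset Strict Implicit.
Unset Printing Implicit Defensive.

Import GRing.Theory.
Local Open Scope ring_scope.

Definition laplacian (R : nzRingType) (n : nat) (P : {mpoly R[n]}) :
  {mpoly R[n]} := \sum_(j < n) P^`M(j)^`M(j).

Definition harmonic_mpoly (R : nzRingType) (n : nat) (P : {mpoly R[n]}) : Prop :=
  laplacian P = 0.

Definition nondegenerate_mpoly (R : realType) (n : nat) (P : {mpoly R[n]}) : Prop :=
  forall omega : 'rV[R]_n, omega != 0 ->
  exists x : 'rV[R]_n, \sum_(j < n) omega 0 j * P^`M(j).@[x 0] != 0.

Definition irreducible_elt (A : idomainType) (a : A) : Prop :=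
  [/\ a != 0, a \isn't a GRing.unit &
      forall b c : A, a = b * c -> b \is a GRing.unit \/ c \is a GRing.unit].

(* A real polynomial is called irreducible when its image in C[x_1, .., x_n]
   is; this is stronger than irreducibility in R[x_1, .., x_n]. *)
Definition irreducible_mpoly (R : realType) (n : nat) (P : {mpoly R[n]}) :
  Prop := irreducible_elt (map_mpoly (real_complex R) P : {mpoly R[i][n]}).

Definition mpoly_dvd (R : nzRingType) (n : nat) (P H : {mpoly R[n]}) : Prop :=
  exists Q : {mpoly R[n]}, H = P * Q.

(* The predicate [free] of the vector library is limited to finite sequences
   in a finite-dimensional space, hence this version for infinite families.
   Dependence relations may be taken among initial segments, since the
   coefficients are allowed to vanish. *)
Definition lin_indep (R : nzRingType) (V : lmodType R) (v : nat -> V) : Prop :=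
  forall (m : nat) (c : 'I_m -> R),
    \sum_(i < m) c i *: v i = 0 -> forall i : 'I_m, c i = 0.

Definition divides_infinitely_many_harmonic (R : realType) (n : nat)
    (P : {mpoly R[n]}) : Prop :=
  exists H : nat -> {mpoly R[n]},
    lin_indep H /\ forall i : nat, harmonic_mpoly (H i) /\ mpoly_dvd P (H i).

(* Main.v *)
From HB Require Import structures.
Require Import Defs.
From mathcomp Require Import all_boot all_order all_algebra.
From mathcomp Require Import complex mpoly reals ring lra zify.
Import GRing.Theory Num.Theory.
Local Open Scope ring_scope.
Set Implicit Arguments.
Unset Strict Implicit.
Unset Printing Implicit Defensive.

(* Let phi = U + iV be a complex polynomial on R^n with vanishing Laplacian and
   with sum_j (d_j phi)^2 = 0 (a harmonic morphism to C).  Then every power of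
   phi is harmonic, hence so is Re (phi^m), and U = Re phi divides Re (phi^m)
   for odd m.  These real parts are independent because phi takes all real
   values s, at points where Re (phi^m) equals s^m.

   Write z_j = x_j + i y_j.  In even dimension take
   phi = z_0 z_1 + sum_(j >= 2) z_j^2, which is holomorphic.  In odd dimension,
   with the extra coordinate t, take
   phi = z_1 - z_0^2 conj(z_1) + 2 z_0 t + sum_(j >= 2) z_j^2;
   the first three terms are <a(z_0), (x_1, y_1, t)> for the isotropic curve
   a(w) = (1 - w^2, i (1 + w^2), 2 w).  Both real parts have the shape
   c X_i X_t + B with B free of X_t and nonzero on X_i = 0, which makes them
   irreducible over C. *)

(** * Irreducibility of polynomials of degree one in some variable *)

Lemma poly_size2_factor (A : idomainType) (p q : {poly A}) :
  size (p * q) = 2%N -> (size p <= 1)%N \/ (size q <= 1)%N.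
Proof.
have [->|p0] := eqVneq p 0; first by rewrite mul0r size_poly0.
have [->|q0] := eqVneq q 0; first by rewrite mulr0 size_poly0.
rewrite size_mul //; lia.
Qed.

Section IrreducibleLinear.
Variables (K : fieldType) (n : nat).
Implicit Types (p q B : {mpoly K[n]}) (i t : 'I_n).

(* A polynomial does not involve ['X_t] iff it is sent to the constant [p%:P]. *)
Definition mpoly_uni t : {mpoly K[n]} -> {poly {mpoly K[n]}} :=
  mmap (polyC \o @mpolyC n K) (fun j => if j == t then 'X else ('X_j)%:P).

Lemma mpoly_uniD t : {morph mpoly_uni t : p q / p + q}.
Proof. by move=> p q; rewrite /mpoly_uni mmapD. Qed.

Lemma mpoly_uniM t : {morph mpoly_uni t : p q / p * q}.
Proof. by move=> p q; rewrite /mpoly_uni rmorphM. Qed.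

Lemma mpoly_uniC t c : mpoly_uni t c%:MP = (c%:MP)%:P.
Proof. exact: mmapC. Qed.

Lemma mpoly_uniX t j :
  mpoly_uni t 'X_j = if j == t then 'X else ('X_j)%:P.
Proof. by rewrite /mpoly_uni mmapX mmap1U. Qed.

(** Substituting ['X_t] back undoes [mpoly_uni]; hence, if the image of p is a constant polynomial,
    that constant is p itself. *)
Lemma mpoly_uniK t p : (mpoly_uni t p).['X_t] = p.
Proof.
elim/mpolyind: p => [|c m p _ _ IH]; first by rewrite -mpolyC0 mpoly_uniC hornerC.
rewrite mpoly_uniD hornerD; congr (_ + _); last exact: IH.
rewrite -mul_mpolyC mpoly_uniM mpoly_uniC hornerM hornerC; congr (_ * _).
rewrite /mpoly_uni mmapX /mmap1 horner_prod [in RHS]mpolyXE_id.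
apply: eq_bigr => j _; rewrite horner_exp.
by case: eqP => [->|_]; rewrite ?hornerX ?hornerC.
Qed.

Lemma mpolyXU_neq0 i : 'X_i != 0 :> {mpoly K[n]}.
Proof. by rewrite -msize_poly_eq0 msizeX. Qed.

Lemma msize1_unit p : msize p = 1%N -> p \is a GRing.unit.
Proof.
move/eqP/msize_poly1P => [c c0 ->].
apply/unitrP; exists c^-1%:MP.
by rewrite -!mpolyCM mulVf // mulfV // mpolyC1.
Qed.

(** Write q_0, q_1 for the coefficients of q in ['X_t]. As p is free of ['X_t], comparing
    coefficients gives p q_1 = c X_i and p q_0 = B. By degree, p or q_1 is constant. If q_1 is, then
    p is a scalar multiple of X_i, so it vanishes at v and B does too, which is excluded. *)
Lemma linear_factor_unit i t (c : K) B v p q :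
  c != 0 -> i != t -> mpoly_uni t B = B%:P -> v i = 0 -> B.@[v] != 0 ->
  c%:MP * 'X_i * 'X_t + B = p * q ->
  (size (mpoly_uni t p) <= 1)%N -> p \is a GRing.unit.
Proof.
move=> c0 it uB vi Bv e /size1_polyC up.
have {up} pC : mpoly_uni t p = p%:P.
  by have := mpoly_uniK t p; rewrite up hornerC => ->.
have: mpoly_uni t (c%:MP * 'X_i * 'X_t + B) = mpoly_uni t (p * q) by rewrite e.
rewrite mpoly_uniD !mpoly_uniM mpoly_uniC !mpoly_uniX eqxx (negPf it) uB pC => e2.
have := congr1 (fun r : {poly {mpoly K[n]}} => r`_1) e2.
have := congr1 (fun r : {poly {mpoly K[n]}} => r`_0) e2.
rewrite !coefD -!polyCM !coefCM !coefX !coefC /= mulr0 add0r mulr1 addr0.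
move=> eB eM.
have cM0 : c%:MP_[n] * 'X_i != 0.
  by rewrite mulf_neq0 ?mpolyXU_neq0 // mpolyC_eq0.
have [p0 q0] : p != 0 /\ (mpoly_uni t q)`_1 != 0.
  by apply/andP; rewrite -negb_or -mulf_eq0 -eM.
have sizes : msize p = 1%N \/ msize (mpoly_uni t q)`_1 = 1%N.
  have := msizeM p0 q0; rewrite -eM mul_mpolyC msizeZ // msizeX mdeg1.
  move: p0 q0; rewrite -!msize_poly_eq0.
  by move: (msize p) (msize (mpoly_uni t q)`_1) => a b; lia.
case: sizes => [/msize1_unit //|/eqP /msize_poly1P [d d0 ed]].
have : p.@[v] = 0.
  have := congr1 (meval v) eM; rewrite ed !mevalM !mevalC mevalXU vi mulr0.
  by move/esym/eqP; rewrite mulf_eq0 (negPf d0) orbF => /eqP.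
by move=> pv; move: Bv; rewrite eB mevalM pv mul0r eqxx.
Qed.

(** The degree in ['X_t] is one, so one of any two factors is free of ['X_t], and
    [linear_factor_unit] applies to it. *)
Lemma irreducible_linear i t (c : K) B v :
  c != 0 -> i != t -> mpoly_uni t B = B%:P -> v i = 0 -> B.@[v] != 0 ->
  irreducible_elt (c%:MP * 'X_i * 'X_t + B).
Proof.
move=> c0 it uB vi Bv; set P := _ + B.
have uP : mpoly_uni t P = (c%:MP * 'X_i)%:P * 'X + B%:P.
  by rewrite mpoly_uniD !mpoly_uniM mpoly_uniC !mpoly_uniX eqxx (negPf it) uB polyCM.
have sP : size (mpoly_uni t P) = 2%N.
  have cM0 : c%:MP_[n] * 'X_i != 0.
    by rewrite mulf_neq0 ?mpolyXU_neq0 // mpolyC_eq0.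
  by rewrite uP size_MXaddC polyC_eq0 (negPf cM0) size_polyC cM0.
split.
- by apply/eqP => P0; move: sP; rewrite P0 -mpolyC0 mpoly_uniC mpolyC0 size_poly0.
(* A unit is a constant, whose image under [mpoly_uni] has size at most 1, not 2. *)
- apply/negP => uP'; have : mpoly_unit P by exact: uP'.
  case/andP => /eqP PC _; move: sP; rewrite PC mpoly_uniC size_polyC.
  by case: (_ != 0).
move=> p q e; have := sP; rewrite e mpoly_uniM.
move/poly_size2_factor => [sp|sq].
- by left; apply: (linear_factor_unit c0 it uB vi Bv e sp).
rewrite mulrC in e.
by right; apply: (linear_factor_unit c0 it uB vi Bv e sq).
Qed.
End IrreducibleLinear.

(** * Products of gradients and the Laplacian *)

Section Gradient.
Variables (K : comNzRingType) (n : nat).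
Implicit Types (p q r : {mpoly K[n]}) (i j : 'I_n).

(* The bilinear (not Hermitian) product of gradients, a symmetric biderivation. *)
Definition grad_prod p q : {mpoly K[n]} := \sum_(j < n) p^`M(j) * q^`M(j).

Lemma grad_prodC p q : grad_prod p q = grad_prod q p.
Proof. by apply: eq_bigr => j _; rewrite mulrC. Qed.

Lemma grad_prod_is_additive p : additive (grad_prod p).
Proof.
move=> q r; rewrite /grad_prod -sumrB.
by apply: eq_bigr => j _; rewrite mderivB mulrBr.
Qed.

HB.instance Definition _ p :=
  GRing.isZmodMorphism.Build {mpoly K[n]} {mpoly K[n]} (grad_prod p)
    (grad_prod_is_additive p).

Lemma grad_prodDr p q r : grad_prod p (q + r) = grad_prod p q + grad_prod p r.
Proof. exact: raddfD. Qed.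

Lemma grad_prodDl p q r : grad_prod (p + q) r = grad_prod p r + grad_prod q r.
Proof. by rewrite grad_prodC grad_prodDr ![grad_prod r _]grad_prodC. Qed.

Lemma grad_prodNr p q : grad_prod p (- q) = - grad_prod p q.
Proof. exact: raddfN. Qed.

Lemma grad_prodNl p q : grad_prod (- p) q = - grad_prod p q.
Proof. by rewrite grad_prodC grad_prodNr grad_prodC. Qed.

Lemma grad_prodMr p q r :
  grad_prod p (q * r) = grad_prod p q * r + q * grad_prod p r.
Proof.
rewrite /grad_prod mulr_suml mulr_sumr -big_split; apply: eq_bigr => j _ /=.
by rewrite mderivM mulrDr mulrA mulrCA.
Qed.

Lemma grad_prodMl p q r :
  grad_prod (p * q) r = grad_prod p r * q + p * grad_prod q r.
Proof. by rewrite grad_prodC grad_prodMr ![grad_prod r _]grad_prodC. Qed.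

Lemma grad_prodCr p c : grad_prod p c%:MP = 0.
Proof. by apply: big1 => j _; rewrite mderivC mulr0. Qed.

Lemma grad_prodCl p c : grad_prod c%:MP p = 0.
Proof. by rewrite grad_prodC grad_prodCr. Qed.

Lemma grad_prod_sumr p (I : finType) (A : pred I) (F : I -> {mpoly K[n]}) :
  grad_prod p (\sum_(k | A k) F k) = \sum_(k | A k) grad_prod p (F k).
Proof. exact: raddf_sum. Qed.

Lemma grad_prod_suml p (I : finType) (A : pred I) (F : I -> {mpoly K[n]}) :
  grad_prod (\sum_(k | A k) F k) p = \sum_(k | A k) grad_prod (F k) p.
Proof.
by rewrite grad_prodC grad_prod_sumr; apply: eq_bigr => k _; apply: grad_prodC.
Qed.

Lemma mderivXU i j : ('X_i)^`M(j) = ((i == j)%:R)%:MP :> {mpoly K[n]}.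
Proof.
rewrite mderivX mnm1E; case: eqP => [->|_].
  by rewrite scale1r -[X in (X - _)%MM]add0m addmK mpolyX0 mpolyC1.
by rewrite scale0r mpolyC0.
Qed.

Lemma grad_prodXX i j : grad_prod 'X_i 'X_j = ((i == j)%:R)%:MP.
Proof.
rewrite /grad_prod (bigD1 i) //= big1 => [|l li].
  by rewrite !mderivXU eqxx mpolyC1 mul1r addr0 eq_sym.
by rewrite mderivXU eq_sym (negPf li) mpolyC0 mul0r.
Qed.

Lemma laplacianD p q : laplacian (p + q) = laplacian p + laplacian q.
Proof.
by rewrite /laplacian -big_split; apply: eq_bigr => j _; rewrite !mderivD.
Qed.

Lemma laplacianN p : laplacian (- p) = - laplacian p.
Proof. by rewrite /laplacian -sumrN; apply: eq_bigr => j _; rewrite !mderivN. Qed.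

Lemma laplacianC c : laplacian c%:MP = 0 :> {mpoly K[n]}.
Proof. by apply: big1 => j _; rewrite mderivC mderiv0. Qed.

Lemma laplacianXU i : laplacian 'X_i = 0 :> {mpoly K[n]}.
Proof. by apply: big1 => j _; rewrite mderivXU mderivC. Qed.

Lemma laplacianM p q :
  laplacian (p * q) = laplacian p * q + p * laplacian q + grad_prod p q *+ 2.
Proof.
rewrite /laplacian /grad_prod mulr_suml mulr_sumr -sumrMnl -!big_split.
apply: eq_bigr => j _ /=.
rewrite !mderivM !mderivD !mderivM; ring.
Qed.

Lemma laplacian_sum (I : finType) (A : pred I) (F : I -> {mpoly K[n]}) :
  laplacian (\sum_(k | A k) F k) = \sum_(k | A k) laplacian (F k).
Proof.
apply: (big_morph (@laplacian K n) (id1 := 0) laplacianD).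
by rewrite -mpolyC0 laplacianC.
Qed.

Lemma grad_prod_exp p q m : grad_prod p q = 0 -> grad_prod p (q ^+ m) = 0.
Proof.
move=> pq; elim: m => [|m IH]; first by rewrite expr0 -mpolyC1 grad_prodCr.
by rewrite exprS grad_prodMr pq IH mul0r mulr0 addr0.
Qed.

(** In the product rule for p times p^m, the cross term pairs the gradients of p and p^m; it is a
    multiple of [grad_prod p p], which is zero. *)
Lemma harmonic_exp p m :
  laplacian p = 0 -> grad_prod p p = 0 -> laplacian (p ^+ m) = 0.
Proof.
move=> lp gp; elim: m => [|m IH]; first by rewrite expr0 -mpolyC1 laplacianC.
by rewrite exprS laplacianM lp IH grad_prod_exp // mul0r mulr0 mul0rn !addr0.
Qed.

End Gradient.

(** * Real and imaginary parts of powers of a harmonic morphism *)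

Lemma poly_fun0 (R : numDomainType) (p : {poly R}) :
  (forall s, p.[s] = 0) -> p = 0.
Proof.
move=> p0; apply/eqP/negPn/negP => pn0.
(* In characteristic zero the integers below [size p] are distinct, which is one root too many. *)
have roots : all (root p) [seq i%:R | i <- iota 0 (size p)].
  by apply/allP => s _; apply/eqP.
have := max_poly_roots pn0 roots.
rewrite size_map size_iota ltnn map_inj_uniq ?iota_uniq; first by move=> /(_ isT).
exact: (mulrIn (oner_neq0 R)).
Qed.

Section ComplexPowers.
Variables (R : numDomainType) (K : comNzRingType) (f : {rmorphism R -> K}).
Variables (iu : K) (n : nat).
Hypothesis iu2 : iu * iu = -1.
Hypothesis iu_free : forall a b, f a + iu * f b = 0 -> a = 0 /\ b = 0.
Implicit Types (U V A B : {mpoly R[n]}).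

Local Notation toC := (map_mpoly f).
Local Notation I := (iu%:MP_[n]).

(** The polynomial U + iV. The ring [K] stands for the complex numbers: [iu] is a square root of -1,
    and [iu_free] makes the parts U and V unique. *)
Definition mpoly_complex U V : {mpoly K[n]} := toC U + I * toC V.

Lemma mulII : I * I = -1 :> {mpoly K[n]}.
Proof. by rewrite -mpolyCM iu2 mpolyCN mpolyC1. Qed.

Lemma mpoly_complexM U V A B :
  mpoly_complex U V * mpoly_complex A B =
  mpoly_complex (U * A - V * B) (U * B + V * A).
Proof.
rewrite /mpoly_complex rmorphB rmorphD !rmorphM /=.
move: (toC U) (toC V) (toC A) (toC B) => u v a b.
have -> : (u + I * v) * (a + I * b) =
  u * a + I * I * (v * b) + I * (u * b + v * a) by ring.
by rewrite mulII mulN1r.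
Qed.

Lemma mcoeff_toC U m : (toC U)@_m = f U@_m.
Proof. exact: mcoeff_map_mpoly. Qed.

Lemma mpoly_complex_eq0 U V : mpoly_complex U V = 0 -> U = 0 /\ V = 0.
Proof.
move=> UV0; suff UV m : U@_m = 0 /\ V@_m = 0.
  by split; apply/mpolyP => m; rewrite mcoeff0; case: (UV m).
have := congr1 (mcoeff m) UV0; rewrite /mpoly_complex mcoeffD mcoeffCM mcoeff0.
by rewrite !mcoeff_toC => /iu_free.
Qed.

Lemma map_mpoly_laplacian U : toC (laplacian U) = laplacian (toC U).
Proof.
have toC_mderiv (j : 'I_n) (A : {mpoly R[n]}) : toC A^`M(j) = (toC A)^`M(j).
  by apply/mpolyP => m; rewrite mcoeff_toC !mcoeff_mderiv mcoeff_toC rmorphMn.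
rewrite /laplacian rmorph_sum; apply: eq_bigr => j _ /=.
by rewrite !toC_mderiv.
Qed.

Lemma laplacian_complex U V :
  laplacian (mpoly_complex U V) = mpoly_complex (laplacian U) (laplacian V).
Proof.
rewrite /mpoly_complex laplacianD laplacianM laplacianC grad_prodCl mul0r add0r.
by rewrite mul0rn addr0 !map_mpoly_laplacian.
Qed.

Fixpoint complex_pow U V m : {mpoly R[n]} * {mpoly R[n]} :=
  if m is m'.+1 then
    let AB := complex_pow U V m' in
    (U * AB.1 - V * AB.2, U * AB.2 + V * AB.1)
  else (1, 0).

Lemma complex_powE U V m :
  mpoly_complex (complex_pow U V m).1 (complex_pow U V m).2 =
  mpoly_complex U V ^+ m.
Proof.
elim: m => [|m IH] /=; last by rewrite -mpoly_complexM IH exprS.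
by rewrite /mpoly_complex rmorph0 rmorph1 mulr0 addr0.
Qed.

(** Modulo U the power (U + iV)^m is (iV)^m, which is purely imaginary for odd m and real for even
    m; the other part is thus divisible by U. Each further factor U + iV exchanges the two cases. *)
Lemma dvd_complex_pow U V m :
  if odd m then mpoly_dvd U (complex_pow U V m).1
  else mpoly_dvd U (complex_pow U V m).2.
Proof.
elim: m => [|m] /=; first by exists 0; rewrite mulr0.
case: (odd m) => -[Q ->] /=.
  by exists ((complex_pow U V m).2 + V * Q); ring.
by exists ((complex_pow U V m).1 - V * Q); ring.
Qed.

Lemma meval_complex_pow U V m v : V.@[v] = 0 ->
  (complex_pow U V m).1.@[v] = U.@[v] ^+ m.
Proof.
move=> V0; elim: m => [|m IH] /=; first by rewrite meval1.
by rewrite mevalB !mevalM V0 mul0r subr0 IH exprS.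
Qed.

Lemma harmonic_morphism_re U V :
  laplacian (mpoly_complex U V) = 0 ->
  grad_prod (mpoly_complex U V) (mpoly_complex U V) = 0 ->
  (forall s, exists v, U.@[v] = s /\ V.@[v] = 0) ->
  harmonic_mpoly U /\ exists H : nat -> {mpoly R[n]},
    lin_indep H /\ forall i : nat, harmonic_mpoly (H i) /\ mpoly_dvd U (H i).
Proof.
move=> lap0 grad0 onto.
split; first by move: lap0; rewrite laplacian_complex => /mpoly_complex_eq0 [].
(* Only odd exponents are taken, since for these U divides the real part. *)
exists (fun j => (complex_pow U V (2 * j).+1).1); split=> [m c c0 k|j].
  (* At a point where U = s and V = 0, the dependence relation becomes the sum of c_i s^(2i+1). It
     vanishes for every s, so each coefficient is zero. *)
  have /polyP/(_ (2 * k).+1) : \sum_(i < m) c i *: 'X^((2 * i).+1) = 0 :> {poly R}.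
    apply: poly_fun0 => s; have [v [Uv Vv]] := onto s.
    have := congr1 (meval v) c0; rewrite meval0 => <-.
    rewrite horner_sum raddf_sum; apply: eq_bigr => i _ /=.
    by rewrite hornerZ hornerXn mevalZ -[(_ * _ - _ * _)]/(complex_pow U V (2 * i).+1).1
      meval_complex_pow // Uv.
  rewrite coef_sum coef0 (bigD1 k) //= big1 => [|i ik].
    by rewrite coefZ coefXn eqxx mulr1 addr0.
  rewrite coefZ coefXn; case: eqP => [e|]; last by rewrite mulr0.
  by case/eqP: ik; apply: ord_inj; lia.
split.
  have := harmonic_exp (2 * j).+1 lap0 grad0.
  by rewrite -complex_powE laplacian_complex => /mpoly_complex_eq0 [].
by have := dvd_complex_pow U V (2 * j).+1; rewrite /= oddM.
Qed.

End ComplexPowers.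

(** * Closure properties of the polynomials free of a given variable *)

Section FreeOf.
Variables (K : fieldType) (n : nat) (t : 'I_n).
Implicit Types p q : {mpoly K[n]}.

Lemma mpoly_uniD_const p q : mpoly_uni t p = p%:P -> mpoly_uni t q = q%:P ->
  mpoly_uni t (p + q) = (p + q)%:P.
Proof. by move=> ep eq; rewrite mpoly_uniD ep eq polyCD. Qed.

Lemma mpoly_uniM_const p q : mpoly_uni t p = p%:P -> mpoly_uni t q = q%:P ->
  mpoly_uni t (p * q) = (p * q)%:P.
Proof. by move=> ep eq; rewrite mpoly_uniM ep eq polyCM. Qed.

Lemma mpoly_uniN_const p : mpoly_uni t p = p%:P -> mpoly_uni t (- p) = (- p)%:P.
Proof.
move=> ep; rewrite -mulN1r -mpolyC1 -mpolyCN.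
by apply: mpoly_uniM_const => //; apply: mpoly_uniC.
Qed.

Lemma mpoly_uniB_const p q : mpoly_uni t p = p%:P -> mpoly_uni t q = q%:P ->
  mpoly_uni t (p - q) = (p - q)%:P.
Proof. by move=> ep eq; apply: mpoly_uniD_const => //; apply: mpoly_uniN_const. Qed.

Lemma mpoly_uniX_const j : j != t -> mpoly_uni t ('X_j : {mpoly K[n]}) = ('X_j)%:P.
Proof. by move=> jt; rewrite mpoly_uniX (negPf jt). Qed.

Lemma mpoly_uni_sum_const (J : finType) (A : pred J) (F : J -> {mpoly K[n]}) :
  (forall j, A j -> mpoly_uni t (F j) = (F j)%:P) ->
  mpoly_uni t (\sum_(j | A j) F j) = (\sum_(j | A j) F j)%:P.
Proof.
move=> FA; apply: (big_ind (fun p => mpoly_uni t p = p%:P)) => //.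
  by rewrite -mpolyC0 mpoly_uniC.
exact: mpoly_uniD_const.
Qed.
End FreeOf.

(** * Nondegeneracy through directional derivatives *)

Section Nondegenerate.
Variables (R : realType) (n : nat).

(** Its gradient is the constant vector w, so [grad_prod p (linear_form w)] is the derivative of p
    in the direction w, and the product rules for [grad_prod] compute it. *)
Definition linear_form (w : 'I_n -> R) : {mpoly R[n]} := \sum_(j < n) (w j)%:MP * 'X_j.

Lemma grad_prod_linear_form w p :
  grad_prod p (linear_form w) = \sum_(j < n) (w j)%:MP * p^`M(j).
Proof.
rewrite grad_prod_sumr; apply: eq_bigr => j _.
rewrite grad_prodMr grad_prodCr mul0r add0r; congr (_ * _).
rewrite /grad_prod (bigD1 j) //= big1 => [|i ij].
  by rewrite mderivXU eqxx mpolyC1 mulr1 addr0.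
by rewrite mderivXU eq_sym (negPf ij) mpolyC0 mulr0.
Qed.

Lemma grad_prodX_linear_form w i : grad_prod 'X_i (linear_form w) = (w i)%:MP.
Proof.
rewrite grad_prod_linear_form (bigD1 i) //= big1 => [|j ji].
  by rewrite mderivXU eqxx mpolyC1 mulr1 addr0.
by rewrite mderivXU eq_sym (negPf ji) mpolyC0 mulr0.
Qed.

Lemma nondegenerate_grad_prod p :
  (forall w, (forall v, (grad_prod p (linear_form w)).@[v] = 0) ->
     forall j, w j = 0) ->
  nondegenerate_mpoly p.
Proof.
move=> H omega omega0; apply: boolp.contrapT => noex.
move/eqP: omega0; apply; apply/rowP => j; rewrite mxE.
apply: (H (fun j => omega 0 j)) => v.
apply/eqP/negPn/negP => nz; apply: noex; exists (\row_j v j).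
move: nz; rewrite grad_prod_linear_form raddf_sum /=.
rewrite (eq_bigr (fun i => omega 0 i * p^`M(i).@[(\row_j v j) 0])) // => i _.
by rewrite mevalM mevalC; congr (_ * _); apply: meval_eq => l; rewrite mxE.
Qed.
End Nondegenerate.

(** * The explicit polynomials in even and odd dimension *)

Section Tail.
Variables (A : comNzRingType) (k n : nat) (x y : 'I_k -> 'I_n) (i0 i1 : 'I_k).

(* Here [x j] and [y j] are the indices of the coordinates x_j and y_j, and
   [i0], [i1] play the parts of 0 and 1; the tail consists of the other j.
   [even_re], [even_im], [odd_re], [odd_im] are Re phi and Im phi for the two
   maps phi, the real parts being displayed in the shape c X_i X_t + B. *)
Definition in_tail : pred 'I_k := [pred j | (j != i0) && (j != i1)].

Definition tail_re : {mpoly A[n]} :=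
  \sum_(j | in_tail j) ('X_(x j) * 'X_(x j) - 'X_(y j) * 'X_(y j)).

(** The two equal products stay separate because [mpoly_complexM] yields the imaginary part of z_j^2
    in this form. *)
Definition tail_im : {mpoly A[n]} :=
  \sum_(j | in_tail j) ('X_(x j) * 'X_(y j) + 'X_(y j) * 'X_(x j)).

Definition even_rest : {mpoly A[n]} := tail_re - 'X_(y i0) * 'X_(y i1).

Definition even_re : {mpoly A[n]} := 1%:MP * 'X_(x i0) * 'X_(x i1) + even_rest.

Definition even_im : {mpoly A[n]} :=
  'X_(x i0) * 'X_(y i1) + 'X_(y i0) * 'X_(x i1) + tail_im.

Variable t : 'I_n.

Definition odd_rest : {mpoly A[n]} :=
  'X_(x i1) - ('X_(x i0) * 'X_(x i0) - 'X_(y i0) * 'X_(y i0)) * 'X_(x i1)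
  - 2%:MP * 'X_(x i0) * 'X_(y i0) * 'X_(y i1) + tail_re.

Definition odd_re : {mpoly A[n]} := 2%:MP * 'X_(x i0) * 'X_t + odd_rest.

Definition odd_im : {mpoly A[n]} :=
  2%:MP * 'X_(y i0) * 'X_t + 'X_(y i1)
  + ('X_(x i0) * 'X_(x i0) - 'X_(y i0) * 'X_(y i0)) * 'X_(y i1)
  - 2%:MP * 'X_(x i0) * 'X_(y i0) * 'X_(x i1) + tail_im.

Lemma meval_tail_re v : (forall j, in_tail j -> v (x j) = 0 /\ v (y j) = 0) ->
  tail_re.@[v] = 0.
Proof.
move=> v0; rewrite /tail_re raddf_sum; apply: big1 => j /v0 [vx vy] /=.
by rewrite mevalB !mevalM !mevalXU vx vy !mul0r subr0.
Qed.

Lemma meval_tail_im v : (forall j, in_tail j -> v (x j) = 0 /\ v (y j) = 0) ->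
  tail_im.@[v] = 0.
Proof.
move=> v0; rewrite /tail_im raddf_sum; apply: big1 => j /v0 [vx vy] /=.
by rewrite mevalD !mevalM !mevalXU vx vy !mul0r addr0.
Qed.
End Tail.

Section MapTail.
Variables (R K : comNzRingType) (f : {rmorphism R -> K}).
Variables (k n : nat) (x y : 'I_k -> 'I_n) (i0 i1 : 'I_k) (t : 'I_n).

Lemma map_tail_re :
  map_mpoly f (tail_re R x y i0 i1) = tail_re K x y i0 i1.
Proof.
rewrite /tail_re rmorph_sum; apply: eq_bigr => j _ /=.
by rewrite rmorphB !rmorphM /= !map_mpolyX.
Qed.

Lemma map_even_re :
  map_mpoly f (even_re R x y i0 i1) = even_re K x y i0 i1.
Proof.
rewrite /even_re /even_rest rmorphD rmorphB !rmorphM /= !map_mpolyX map_tail_re.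
by rewrite map_mpolyC /= (rmorph1 f).
Qed.

Lemma map_odd_re :
  map_mpoly f (odd_re R x y i0 i1 t) = odd_re K x y i0 i1 t.
Proof.
rewrite /odd_re /odd_rest !(rmorphD, rmorphN, rmorphM) /= !map_mpolyX map_tail_re.
by rewrite !map_mpolyC /= (rmorph1 f).
Qed.
End MapTail.

(** * The two maps phi are harmonic with isotropic gradient *)

Section Isotropic.
Variables (R : numDomainType) (K : comNzRingType) (f : {rmorphism R -> K}).
Variables (iu : K) (k n : nat) (x y : 'I_k -> 'I_n) (i0 i1 : 'I_k).
Hypothesis iu2 : iu * iu = -1.
Hypothesis x_eq : forall i j, (x i == x j) = (i == j).
Hypothesis y_eq : forall i j, (y i == y j) = (i == j).
Hypothesis xy_eq : forall i j, (x i == y j) = false.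
Hypothesis i01 : (i0 == i1) = false.

Local Notation I := (iu%:MP_[n]).
Local Notation zc j := ('X_(x j) + I * 'X_(y j)).
Local Notation zb j := ('X_(x j) - I * 'X_(y j)).

Let yx_eq i j : (y i == x j) = false. Proof. by rewrite eq_sym. Qed.

Let gradE := (grad_prodDl, grad_prodDr, grad_prodNl, grad_prodNr, grad_prodMl,
  grad_prodMr, grad_prodCl, grad_prodCr, grad_prodXX, x_eq, y_eq, xy_eq, yx_eq,
  mpolyC0, mul0r, mulr0, add0r, addr0).

(** In the plane of x_j and y_j the gradient of z_j is (1, i), and 1 + i^2 = 0; gradients in
    different planes are orthogonal. *)
Lemma grad_zz i j : grad_prod (zc i) (zc j) = 0.
Proof.
rewrite !gradE; transitivity ((1 + I * I) * ((i == j)%:R)%:MP); first by ring.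
by rewrite mulII // subrr mul0r.
Qed.

Lemma grad_zbzb i j : grad_prod (zb i) (zb j) = 0.
Proof.
rewrite !gradE; transitivity ((1 + I * I) * ((i == j)%:R)%:MP); first by ring.
by rewrite mulII // subrr mul0r.
Qed.

(** For i = j the pairing of (1, -i) with (1, i) is 1 - i^2 = 2. In odd dimension this nonzero value
    is balanced by the coordinate t. *)
Lemma grad_zbz i j : grad_prod (zb i) (zc j) = ((i == j)%:R)%:MP *+ 2.
Proof.
rewrite !gradE; transitivity ((1 - I * I) * ((i == j)%:R)%:MP); first by ring.
by rewrite mulII // opprK mulrDl mul1r.
Qed.

Lemma laplacian_z j : laplacian (zc j) = 0.
Proof.
by rewrite laplacianD laplacianM !laplacianXU laplacianC grad_prodCl
  mul0r mulr0 mul0rn !addr0.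
Qed.

Lemma laplacian_zb j : laplacian (zb j) = 0.
Proof.
by rewrite laplacianD laplacianN laplacianM !laplacianXU laplacianC grad_prodCl
  mul0r mulr0 mul0rn !addr0 oppr0 addr0.
Qed.

Definition tail_complex : {mpoly K[n]} :=
  \sum_(j | in_tail i0 i1 j) zc j * zc j.

Lemma grad_tail p : (forall j, in_tail i0 i1 j -> grad_prod p (zc j) = 0) ->
  grad_prod p tail_complex = 0.
Proof.
move=> pz; rewrite grad_prod_sumr; apply: big1 => j /pz pj.
by rewrite grad_prodMr pj mul0r mulr0 addr0.
Qed.

Lemma grad_tail_tail : grad_prod tail_complex tail_complex = 0.
Proof.
apply: grad_tail => j _; rewrite grad_prodC; apply: grad_tail => i _.
exact: grad_zz.
Qed.

Lemma laplacian_tail : laplacian tail_complex = 0.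
Proof.
rewrite laplacian_sum; apply: big1 => j _.
by rewrite laplacianM laplacian_z grad_zz mul0r mulr0 mul0rn !addr0.
Qed.

Lemma mpoly_complexX i j :
  mpoly_complex f iu ('X_i : {mpoly R[n]}) 'X_j = 'X_i + I * 'X_j.
Proof. by rewrite /mpoly_complex !map_mpolyX. Qed.

Lemma mpoly_complexD (U V A B : {mpoly R[n]}) :
  mpoly_complex f iu (U + A) (V + B) =
  mpoly_complex f iu U V + mpoly_complex f iu A B.
Proof. by rewrite /mpoly_complex !rmorphD mulrDr addrACA. Qed.

Lemma mpoly_complex_tail :
  mpoly_complex f iu (tail_re R x y i0 i1) (tail_im R x y i0 i1) = tail_complex.
Proof.
rewrite /mpoly_complex !rmorph_sum mulr_sumr -big_split; apply: eq_bigr => j _.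
by rewrite -mpoly_complexX mpoly_complexM.
Qed.

Lemma mpoly_complex_even :
  mpoly_complex f iu (even_re R x y i0 i1) (even_im R x y i0 i1) =
  zc i0 * zc i1 + tail_complex.
Proof.
rewrite -mpoly_complex_tail -!mpoly_complexX mpoly_complexM // -mpoly_complexD.
congr mpoly_complex; rewrite /even_re /even_rest /even_im mpolyC1; ring.
Qed.

(** All pairings among the z_j vanish and each z_j is harmonic, so the product rules leave no term
    for a polynomial in the z_j. *)
Lemma even_harmonic_morphism (p := zc i0 * zc i1 + tail_complex) :
  laplacian p = 0 /\ grad_prod p p = 0.
Proof.
have gz j : grad_prod (zc j) tail_complex = 0.
  by apply: grad_tail => i _; apply: grad_zz.
rewrite /p laplacianD laplacianM !laplacian_z laplacian_tail grad_zz.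
split; first by rewrite mul0r mulr0 mul0rn !addr0.
rewrite grad_prodDl grad_prodMl 2!grad_prodDr gz gz !(grad_prodMr _ (zc i0)).
rewrite !grad_zz grad_prodDr grad_tail_tail grad_prodMr.
rewrite !(grad_prodC tail_complex) !gz.
by rewrite !(mul0r, mulr0, addr0).
Qed.

Variable t : 'I_n.
Hypothesis xt_eq : forall i, (x i == t) = false.
Hypothesis yt_eq : forall i, (y i == t) = false.

Lemma grad_zt j : grad_prod (zc j) 'X_t = 0.
Proof. by rewrite grad_prodDl grad_prodMl !grad_prodXX xt_eq yt_eq grad_prodCl
  !(mpolyC0, mul0r, mulr0, addr0). Qed.

Lemma grad_zbt j : grad_prod (zb j) 'X_t = 0.
Proof. by rewrite grad_prodDl grad_prodNl grad_prodMl !grad_prodXX xt_eq yt_eq grad_prodCl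
  !(mpolyC0, mul0r, mulr0, addr0, oppr0). Qed.

Definition odd_complex : {mpoly K[n]} :=
  zc i1 - zc i0 * zc i0 * zb i1 + 2%:MP * zc i0 * 'X_t + tail_complex.

Lemma mpoly_complex_odd :
  mpoly_complex f iu (odd_re R x y i0 i1 t) (odd_im R x y i0 i1 t) = odd_complex.
Proof.
rewrite /odd_complex -mpoly_complex_tail /odd_re /odd_rest /odd_im /mpoly_complex.
rewrite !(rmorphD, rmorphN, rmorphM) /= !map_mpolyX !map_mpolyC /= (rmorph1 f).
rewrite !mpolyC1.
have e := mulII n iu2; move: e.
move: (map_mpoly f _) (map_mpoly f _) => S T.
move: I => J.
move: 'X_(x i0) 'X_(y i0) 'X_(x i1) 'X_(y i1) 'X_t => a b c d u e.
apply/eqP; rewrite -subr_eq0; apply/eqP.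
(* The two sides agree only modulo J^2 + 1; the second factor is the quotient of their difference by
   it. *)
transitivity ((J * J + 1) * (b * b * c - 2 * a * b * d - J * b * b * d)).
  by ring.
by rewrite e addNr mul0r.
Qed.

(** The gradient of z_0 is isotropic and orthogonal to those of z_1, conj(z_1), t and the tail,
    which makes every term harmonic. In the square of the gradient only two contributions survive:
    -4 z_0^2 from z_1 against z_0^2 conj(z_1), and 4 z_0^2 from 2 z_0 t against itself. They
    cancel. *)
Lemma odd_harmonic_morphism :
  laplacian odd_complex = 0 /\ grad_prod odd_complex odd_complex = 0.
Proof.
have gz j : grad_prod (zc j) tail_complex = 0.
  by apply: grad_tail => i _; apply: grad_zz.
have gzb : grad_prod (zb i1) tail_complex = 0.
  apply: grad_tail => j /andP [_ j1]; rewrite grad_zbz eq_sym (negPf j1).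
  by rewrite mpolyC0 mul0rn.
have gt : grad_prod 'X_t tail_complex = 0.
  by apply: grad_tail => j _; rewrite grad_prodC grad_zt.
have gt0 := grad_zt i0; have gt1 := grad_zt i1; have gtb := grad_zbt i1.
have g00 := grad_zz i0 i0; have g01 := grad_zz i0 i1; have g11 := grad_zz i1 i1.
have gb0 : grad_prod (zb i1) (zc i0) = 0.
  by rewrite grad_zbz eq_sym i01 mpolyC0 mul0rn.
have gb1 : grad_prod (zb i1) (zc i1) = 2.
  by rewrite grad_zbz eqxx mpolyC1.
have gbb := grad_zbzb i1 i1.
have gtt : grad_prod 'X_t 'X_t = 1 :> {mpoly K[n]}.
  by rewrite grad_prodXX eqxx mpolyC1.
have gss := grad_tail_tail; have ls := laplacian_tail.
have gz0 := gz i0; have gz1 := gz i1.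
have l0 := laplacian_z i0; have l1 := laplacian_z i1; have lb := laplacian_zb i1.
have lt := laplacianXU K t.
rewrite /odd_complex.
(* From here on only the table of pairings and Laplacians matters; w, z, c, S, u stand for z_0, z_1,
   conj(z_1), the tail and t. *)
move: (zc i0) (zc i1) (zb i1) tail_complex ('X_t : {mpoly K[n]})
  gz0 gz1 gzb gt gt0 gt1 gtb g00 g01 g11 gb0 gb1 gbb gtt gss ls l0 l1 lb lt.
move=> w z c S u gz0 gz1 gzb gt gt0 gt1 gtb g00 g01 g11 gb0 gb1 gbb gtt
  gss ls l0 l1 lb lt.
have s (p q e : {mpoly K[n]}) : grad_prod p q = e -> grad_prod q p = e.
  by rewrite grad_prodC.
have H := (gz0, gz1, gzb, gt, gt0, gt1, gtb, g00, g01, g11, gb0, gb1, gbb, gtt, gss,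
  s _ _ _ gz0, s _ _ _ gz1, s _ _ _ gzb, s _ _ _ gt, s _ _ _ gt0, s _ _ _ gt1,
  s _ _ _ gtb, s _ _ _ g01, s _ _ _ gb0, s _ _ _ gb1).
have HE := (grad_prodDl, grad_prodDr, grad_prodNl, grad_prodNr, grad_prodMl,
  grad_prodMr, grad_prodCl, grad_prodCr).
split.
  rewrite !(laplacianD, laplacianN, laplacianM, ls, l0, l1, lb, lt, laplacianC).
  rewrite !HE !H.
  by rewrite !(mul0r, mulr0, addr0, add0r, mul0rn, oppr0).
rewrite !HE !H mpolyC_nat; ring.
Qed.
End Isotropic.

(** * Even dimension: nondegeneracy, irreducibility and divisibility *)

Lemma sqr_im (R : realType) : ('i%C : R[i]) * 'i%C = -1.
Proof. by rewrite -expr2 sqr_i. Qed.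

Lemma im_free (R : realType) (a b : R) :
  real_complex R a + 'i%C * real_complex R b = 0 -> a = 0 /\ b = 0.
Proof.
move/eqP; rewrite eq_complex /= !mul0r !mul1r subr0 addr0 !add0r.
by case/andP => /eqP -> /eqP ->.
Qed.

Section Coordinates.
Variables (R : realType) (k n : nat) (x y : 'I_k -> 'I_n) (i0 i1 : 'I_k).
Hypothesis x_eq : forall i j, (x i == x j) = (i == j).
Hypothesis y_eq : forall i j, (y i == y j) = (i == j).
Hypothesis xy_eq : forall i j, (x i == y j) = false.
Hypothesis i01 : (i0 == i1) = false.

Let yx_eq i j : (y i == x j) = false. Proof. by rewrite eq_sym. Qed.
Let i10 : (i1 == i0) = false. Proof. by rewrite eq_sym. Qed.
Let iE := (x_eq, y_eq, xy_eq, yx_eq, i01, i10, eqxx).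

Local Notation delta i := (fun l : 'I_n => (l == i)%:R : R).

Let not_tail0 j : in_tail i0 i1 j -> (j == i0) = false.
Proof. by case/andP => /negPf. Qed.

Let not_tail1 j : in_tail i0 i1 j -> (j == i1) = false.
Proof. by case/andP => _ /negPf. Qed.

Let tail_not0 j : in_tail i0 i1 j -> (i0 == j) = false.
Proof. by rewrite eq_sym => /not_tail0. Qed.

Let tail_not1 j : in_tail i0 i1 j -> (i1 == j) = false.
Proof. by rewrite eq_sym => /not_tail1. Qed.

(** The derivative of the quadratic form [tail_re] at v in the direction w. *)
Definition tail_form (w v : 'I_n -> R) : R :=
  \sum_(j | in_tail i0 i1 j) (w (x j) * v (x j) - w (y j) * v (y j)) *+ 2.

Lemma grad_tail_re w v :
  (grad_prod (tail_re R x y i0 i1) (linear_form w)).@[v] = tail_form w v.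
Proof.
rewrite grad_prod_suml raddf_sum; apply: eq_bigr => j _ /=.
rewrite grad_prodDl grad_prodNl !grad_prodMl !grad_prodX_linear_form.
rewrite mevalD mevalN !mevalD !mevalM !mevalC !mevalXU; ring.
Qed.

Lemma tail_form0 w v : (forall j, in_tail i0 i1 j -> v (x j) = 0 /\ v (y j) = 0) ->
  tail_form w v = 0.
Proof.
move=> v0; apply: big1 => j /v0 [-> ->].
by rewrite !mulr0 subr0 mul0rn.
Qed.

Lemma tail_formx w j : in_tail i0 i1 j -> tail_form w (delta (x j)) = w (x j) *+ 2.
Proof.
move=> tj; rewrite /tail_form (bigD1 j) //= big1 => [|i /andP [_ ij]].
  by rewrite !iE mulr1 mulr0 subr0 addr0.
by rewrite !iE (negPf ij) !mulr0 subr0 mul0rn.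
Qed.

Lemma tail_formy w j : in_tail i0 i1 j -> tail_form w (delta (y j)) = - w (y j) *+ 2.
Proof.
move=> tj; rewrite /tail_form (bigD1 j) //= big1 => [|i /andP [_ ij]].
  by rewrite !iE mulr1 mulr0 sub0r addr0.
by rewrite !iE (negPf ij) !mulr0 subr0 mul0rn.
Qed.

Let mul2_eq0 (a : R) : a *+ 2 = 0 -> a = 0.
Proof. by move/eqP; rewrite mulrn_eq0 => /eqP. Qed.

Lemma coord_ind (P : 'I_k -> Prop) :
  P i0 -> P i1 -> (forall j, in_tail i0 i1 j -> P j) -> forall j, P j.
Proof.
move=> P0 P1 Pt j; have [->//|j0] := eqVneq j i0.
by have [->//|j1] := eqVneq j i1; apply: Pt; rewrite /in_tail /= j0 j1.
Qed.

Lemma grad_even_re w v :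
  (grad_prod (even_re R x y i0 i1) (linear_form w)).@[v] =
  w (x i0) * v (x i1) + v (x i0) * w (x i1)
  - (w (y i0) * v (y i1) + v (y i0) * w (y i1)) + tail_form w v.
Proof.
rewrite /even_re /even_rest mpolyC1 mul1r.
rewrite !(grad_prodDl, grad_prodNl, grad_prodMl, grad_prodX_linear_form).
rewrite !(mevalD, mevalN, mevalM, mevalC, mevalXU) grad_tail_re; ring.
Qed.

(** The derivative at v in the direction w is the polar form of a quadratic form. At the basis
    vectors v it returns the coordinates of w up to a nonzero factor: x_0 and x_1 are dual to each
    other, as are y_0 and y_1, and each tail coordinate is dual to itself. *)
Lemma nondegenerate_even :
  (forall l, (exists j, l = x j) \/ (exists j, l = y j)) ->
  nondegenerate_mpoly (even_re R x y i0 i1).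
Proof.
move=> cover; apply: nondegenerate_grad_prod => w w0.
have E v := grad_even_re w v; have {}E v := etrans (esym (E v)) (w0 v).
have head l : (forall j, in_tail i0 i1 j -> (x j == l) = false) ->
    (forall j, in_tail i0 i1 j -> (y j == l) = false) ->
    tail_form w (delta l) = 0.
  by move=> xl yl; apply: tail_form0 => j tj; rewrite xl // yl.
have wx : forall j, w (x j) = 0.
  apply: coord_ind => [||j tj].
  - have := E (delta (x i1)); rewrite head ?iE /= => [|j tj|j tj].
    + by rewrite !(mulr0, mul0r, mulr1, addr0, subr0).
    + by rewrite !iE not_tail1.
    + by rewrite !iE.
  - have := E (delta (x i0)); rewrite head ?iE /= => [|j tj|j tj].
    + by rewrite !(mulr0, mul0r, mul1r, addr0, add0r, oppr0).
    + by rewrite !iE not_tail0.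
    + by rewrite !iE.
  - have := E (delta (x j)); rewrite tail_formx // !iE.
    rewrite tail_not0 // tail_not1 // !(mulr0, mul0r, addr0, subr0, add0r, oppr0).
    exact: mul2_eq0.
have wy : forall j, w (y j) = 0.
  apply: coord_ind => [||j tj].
  - have := E (delta (y i1)); rewrite head ?iE /= => [|j tj|j tj].
    + rewrite !(mulr0, mul0r, mulr1, addr0, add0r, sub0r).
      by move/eqP; rewrite oppr_eq0 => /eqP.
    + by rewrite !iE.
    + by rewrite !iE not_tail1.
  - have := E (delta (y i0)); rewrite head ?iE /= => [|j tj|j tj].
    + rewrite !(mulr0, mul0r, mul1r, addr0, add0r, sub0r).
      by move/eqP; rewrite oppr_eq0 => /eqP.
    + by rewrite !iE.
    + by rewrite !iE not_tail0.
  - have := E (delta (y j)); rewrite tail_formy // !iE.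
    rewrite tail_not0 // tail_not1 // !(mulr0, mul0r, addr0, subr0, add0r, oppr0).
    by move/mul2_eq0/eqP; rewrite oppr_eq0 => /eqP.
by move=> l; case: (cover l) => -[j ->].
Qed.

Lemma even_re_homog : even_re R x y i0 i1 \is 2.-homog.
Proof.
have XX i j : 'X_i * 'X_j \is [in R[n], 2.-homog].
  by apply: (@dhomogM _ _ _ 1 _ 1); rewrite dhomogX /= mdeg1.
rewrite /even_re /even_rest mpolyC1 mul1r /tail_re.
apply: rpredD => //; apply: rpredB => //; apply: rpred_sum => j _.
by apply: rpredB.
Qed.

Lemma irreducible_even : irreducible_mpoly (even_re R x y i0 i1).
Proof.
rewrite /irreducible_mpoly map_even_re.
(* The point has y_0 = y_1 = 1 and all other coordinates zero, so x_0 vanishes there while B = -y_0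
   y_1 + tail is -1. *)
apply: (irreducible_linear (v := fun l => (l == y i0)%:R + (l == y i1)%:R)).
- exact: oner_neq0.
- by rewrite !iE.
- rewrite /even_rest /tail_re; apply: mpoly_uniB_const.
    apply: mpoly_uni_sum_const => j tj.
    apply: mpoly_uniB_const; apply: mpoly_uniM_const;
      by apply: mpoly_uniX_const; rewrite iE // not_tail1.
  by apply: mpoly_uniM_const; apply: mpoly_uniX_const; rewrite iE.
- by rewrite !iE addr0.
- rewrite /even_rest mevalB mevalM !mevalXU !iE meval_tail_re => [|j tj].
    by rewrite !(add0r, addr0, mulr1, sub0r) oppr_eq0 oner_neq0.
  by rewrite !iE not_tail0 // not_tail1 // !addr0.
Qed.

Lemma even_re_onto s : exists v,
  (even_re R x y i0 i1).@[v] = s /\ (even_im R x y i0 i1).@[v] = 0.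
Proof.
(* At z_0 = s, z_1 = 1 and zero tail, phi is s. *)
exists (fun l => s * (l == x i0)%:R + (l == x i1)%:R); set v := fun l => _.
have v0 j : in_tail i0 i1 j -> v (x j) = 0 /\ v (y j) = 0.
  by move=> tj; rewrite /v !iE not_tail0 // not_tail1 // !(mulr0, addr0).
rewrite /even_re /even_im /even_rest.
by rewrite !(mevalD, mevalN, mevalM, mevalC, mevalXU) meval_tail_re //
  meval_tail_im // /v !iE !(mulr0, mul0r, mulr1, mul1r, addr0, add0r, oppr0).
Qed.

Lemma even_divides : harmonic_mpoly (even_re R x y i0 i1) /\
  divides_infinitely_many_harmonic (even_re R x y i0 i1).
Proof.
have [lap grad] := even_harmonic_morphism i0 i1 (@sqr_im R) x_eq y_eq xy_eq.
have e := mpoly_complex_even (real_complex R) x y i0 i1 (@sqr_im R).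
rewrite -e in lap grad.
exact: (harmonic_morphism_re (@sqr_im R) (@im_free R) lap grad even_re_onto).
Qed.

(** * Odd dimension: the same properties with the extra coordinate t *)

Variable t : 'I_n.
Hypothesis xt_eq : forall i, (x i == t) = false.
Hypothesis yt_eq : forall i, (y i == t) = false.
Let tx_eq i : (t == x i) = false. Proof. by rewrite eq_sym. Qed.
Let ty_eq i : (t == y i) = false. Proof. by rewrite eq_sym. Qed.
Let tE := (iE, xt_eq, yt_eq, tx_eq, ty_eq).

Lemma grad_odd_re w v (a := x i0) (b := y i0) (c := x i1) (d := y i1) :
  (grad_prod (odd_re R x y i0 i1 t) (linear_form w)).@[v] =
  2 * (w a * v t + v a * w t) + w c
  - ((2 * v a * w a - 2 * v b * w b) * v c + (v a ^+ 2 - v b ^+ 2) * w c)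
  - 2 * (w a * v b * v d + v a * w b * v d + v a * v b * w d) + tail_form w v.
Proof.
rewrite /odd_re /odd_rest.
rewrite !(grad_prodDl, grad_prodNl, grad_prodMl, grad_prodX_linear_form, grad_prodCl).
rewrite !(mevalD, mevalN, mevalM, mevalC, mevalXU, meval0) grad_tail_re.
rewrite /a /b /c /d; ring.
Qed.

Lemma nondegenerate_odd :
  (forall l, [\/ exists j, l = x j, exists j, l = y j | l = t]) ->
  nondegenerate_mpoly (odd_re R x y i0 i1 t).
Proof.
move=> cover; apply: nondegenerate_grad_prod => w w0.
have E v := etrans (esym (grad_odd_re w v)) (w0 v).
(* The point with (x_0, y_0, x_1, y_1, t) = (p, q, r, s, u) and zero tail. *)
pose head (p q r s u : R) l := p * (l == x i0)%:R + q * (l == y i0)%:R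
  + r * (l == x i1)%:R + s * (l == y i1)%:R + u * (l == t)%:R.
have {}E' p q r s u := E (head p q r s u).
have {E'} E' p q r s u : 2 * (w (x i0) * u + p * w t) + w (x i1)
  - ((2 * p * w (x i0) - 2 * q * w (y i0)) * r + (p ^+ 2 - q ^+ 2) * w (x i1))
  - 2 * (w (x i0) * q * s + p * w (y i0) * s + p * q * w (y i1)) = 0.
  have := E' p q r s u; rewrite tail_form0 => [|j tj]; last first.
    by rewrite /head !tE not_tail0 // not_tail1 // !(mulr0, addr0).
  by rewrite /head !tE !(mulr0, mulr1, addr0, add0r).
(* At the origin only the linear term x_1 contributes. Each further test point brings in one new
   coordinate of w besides those already known to vanish. *)
have wc : w (x i1) = 0 by have := E' 0 0 0 0 0; lra.
have wa : w (x i0) = 0 by have := E' 0 0 0 0 1; lra.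
have wt : w t = 0 by have := E' 1 0 0 0 0; lra.
have wd : w (y i1) = 0 by have := E' 1 1 0 0 0; lra.
have wb : w (y i0) = 0 by have := E' 0 1 1 0 0; lra.
have wx : forall j, w (x j) = 0.
  apply: coord_ind => // j tj; apply: mul2_eq0.
  have := E (delta (x j)); rewrite tail_formx // wc wa wt wd wb !tE.
  by rewrite tail_not0 // tail_not1 // !(mulr0, mul0r, addr0, subr0, add0r, oppr0).
have wy : forall j, w (y j) = 0.
  apply: coord_ind => // j tj; apply/eqP; rewrite -oppr_eq0; apply/eqP/mul2_eq0.
  have := E (delta (y j)); rewrite tail_formy // wc wa wt wd wb !tE.
  by rewrite tail_not0 // tail_not1 // !(mulr0, mul0r, addr0, subr0, add0r, oppr0).
by move=> l; case: (cover l) => [[j ->]|[j ->]|->].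
Qed.

Lemma irreducible_odd : irreducible_mpoly (odd_re R x y i0 i1 t).
Proof.
rewrite /irreducible_mpoly map_odd_re.
(* At x_1 = 1 and all other coordinates zero, x_0 vanishes and the linear term gives B = 1. *)
apply: (irreducible_linear (v := fun l => (l == x i1)%:R)).
- by rewrite pnatr_eq0.
- by rewrite tE.
- have X j : j != t -> mpoly_uni t ('X_j : {mpoly R[i][n]}) = ('X_j)%:P.
    exact: mpoly_uniX_const.
  have Xx j := X _ (negbT (xt_eq j)); have Xy j := X _ (negbT (yt_eq j)).
  have C2 := mpoly_uniC t (2 : R[i]).
  rewrite /odd_rest /tail_re.
  repeat first [exact: Xx | exact: Xy | exact: C2 | apply: mpoly_uniB_const
    | apply: mpoly_uniD_const | apply: mpoly_uniM_const
    | apply: mpoly_uni_sum_const => ? ?].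
- by rewrite !tE.
- rewrite /odd_rest !(mevalD, mevalN, mevalM, mevalC, mevalXU) !tE.
  rewrite meval_tail_re => [|j tj]; last by rewrite !tE not_tail1.
  by rewrite !(mulr0, mul0r, addr0, oppr0) oner_neq0.
Qed.

Lemma odd_re_onto s : exists v,
  (odd_re R x y i0 i1 t).@[v] = s /\ (odd_im R x y i0 i1 t).@[v] = 0.
Proof.
(* With z_0 = 0, t = 0 and zero tail, phi reduces to z_1, here equal to s. *)
exists (fun l => s * (l == x i1)%:R); set v := fun l => _.
have v0 j : in_tail i0 i1 j -> v (x j) = 0 /\ v (y j) = 0.
  by move=> tj; rewrite /v !iE not_tail1 // mulr0.
rewrite /odd_re /odd_im /odd_rest.
by rewrite !(mevalD, mevalN, mevalM, mevalC, mevalXU) meval_tail_re //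
  meval_tail_im // /v !tE !(mulr0, mul0r, mulr1, addr0, add0r, oppr0).
Qed.

Lemma odd_divides : harmonic_mpoly (odd_re R x y i0 i1 t) /\
  divides_infinitely_many_harmonic (odd_re R x y i0 i1 t).
Proof.
have [lap grad] := odd_harmonic_morphism (@sqr_im R) x_eq y_eq xy_eq i01 xt_eq yt_eq.
have e := mpoly_complex_odd (real_complex R) x y i0 i1 (@sqr_im R) t.
rewrite -e in lap grad.
exact: (harmonic_morphism_re (@sqr_im R) (@im_free R) lap grad odd_re_onto).
Qed.

End Coordinates.

(** * Choice of coordinates and conclusion *)

Theorem theorem2 (R : realType) :
  (forall k : nat, (2 <= k)%N ->
     exists P : {mpoly R[(2 * k)%N]},
       [/\ irreducible_mpoly P, nondegenerate_mpoly P, P \is 2.-homog, harmonic_mpoly P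
         & divides_infinitely_many_harmonic P]) /\
  (forall k : nat, (2 <= k)%N ->
     exists P : {mpoly R[(2 * k + 1)%N]},
       [/\ irreducible_mpoly P, nondegenerate_mpoly P, harmonic_mpoly P
         & divides_infinitely_many_harmonic P]).
Proof.
split=> k k2; rewrite mul2n -addnn.
(* The first k of the k + k coordinates are the x_j, the last k the y_j; the bound on k provides the
   indices 0 and 1. *)
- pose i0 := Ordinal (ltnW k2); pose i1 := Ordinal k2.
  pose x : 'I_k -> 'I_(k + k) := @lshift k k.
  pose y : 'I_k -> 'I_(k + k) := @rshift k k.
  have x_eq i j : (x i == x j) = (i == j) by rewrite eq_lshift.
  have y_eq i j : (y i == y j) = (i == j) by rewrite eq_rshift.
  have xy_eq i j : (x i == y j) = false by rewrite eq_lrshift.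
  have i01 : (i0 == i1) = false by [].
  have [harm divs] := even_divides R x_eq y_eq xy_eq i01.
  exists (even_re R x y i0 i1); split=> //.
  + exact: irreducible_even.
  + apply: nondegenerate_even => // l; case: (split_ordP l) => j ->.
      by left; exists j.
    by right; exists j.
  + exact: even_re_homog.
(* The same layout, with t as the last coordinate. *)
- pose i0 := Ordinal (ltnW k2); pose i1 := Ordinal k2.
  pose x j : 'I_(k + k + 1) := lshift 1 (@lshift k k j).
  pose y j : 'I_(k + k + 1) := lshift 1 (@rshift k k j).
  pose t : 'I_(k + k + 1) := rshift (k + k) ord0.
  have x_eq i j : (x i == x j) = (i == j) by rewrite !eq_lshift.
  have y_eq i j : (y i == y j) = (i == j) by rewrite eq_lshift eq_rshift.
  have xy_eq i j : (x i == y j) = false by rewrite eq_lshift eq_lrshift.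
  have i01 : (i0 == i1) = false by [].
  have xt_eq i : (x i == t) = false by rewrite eq_lrshift.
  have yt_eq i : (y i == t) = false by rewrite eq_lrshift.
  have [harm divs] := odd_divides R x_eq y_eq xy_eq i01 xt_eq yt_eq.
  exists (odd_re R x y i0 i1 t); split=> //.
  + exact: irreducible_odd.
  + apply: nondegenerate_odd => // l; case: (split_ordP l) => j ->; last first.
      by constructor 3; rewrite (ord1 j).
    case: (split_ordP j) => i ->.
      by constructor 1; exists i.
    by constructor 2; exists i.
Qed.
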